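(* Let $(X,\mathcal{A},p)$ be a standard Borel probability space, let $e$ be a measure-preserving, $p$-a.s. idempotent Markov kernel on $(X,\mathcal{A},p)$, and let $\mathcal{B}\subseteq\mathcal{A}$ be a sub-$\sigma$-algebra. Then $\mathcal{B}\subseteq\mathcal{I}_e$ if and only if $e_\mathcal{B}\le e$. In other words, the order-preserving assignment $\mathcal{B}\mapsto e_\mathcal{B}$ (from sub-$\sigma$-algebras ordered by inclusion to idempotents) is left adjoint to the order-preserving assignment $e\mapsto\mathcal{I}_e$.
   Context: Kernels are identified up to $p$-a.s. equality (for each $B$, equal $p$-a.e.), with composition $(\ell\circ k)(C\mid x)=\int\ell(C\mid y)k(dy\mid x)$. $e$ is $p$-a.s. idempotent if $e\circ e=e$ a.s. $\mathcal{I}_e=\{B\in\mathcal{A}: e(B\mid x)=1_B(x)$ for $p$-a.a. $x\}$. $e_\mathcal{B}$ is the (a.s.-class of the) kernel $e_\mathcal{B}(A\mid x)=\mathbb{P}[A\mid\mathcal{B}](x)=\mathbb{E}[1_A\mid\mathcal{B}](x)$, a regular conditional probability. The order on idempotents: $e_1\le e_2$ iff $e_1\circ e_2=e_2\circ e_1=e_1$ almost surely. *)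

(* Defs.v *)
From HB Require Import structures.
From mathcomp Require Import all_boot all_order all_algebra.
From mathcomp Require Import all_classical all_reals all_analysis.
From mathcomp Require Import measurable_realfun.
Set Implicit Arguments. Unset Strict Implicit. Unset Printing Implicit Defensive.
Import Order.TTheory GRing.Theory Num.Theory.
Local Open Scope classical_set_scope.
Local Open Scope ring_scope.
Local Open Scope ereal_scope.

Section defs.
Context {d : measure_display} {X : measurableType d} {R : realType}.

(** Standard Borel space: X is Borel-isomorphic to a Borel subset of R
    (Kuratowski's characterization). *)
Definition standard_Borel :=
  exists f : X -> R,
    [/\ injective f, measurable_fun [set: X] f, measurable (range f)
      & forall A : set X, measurable A -> measurable (f @` A)].

Definition kcomp_m (l k : R.-pker X ~> X) : X -> set X -> \bar R :=
  fun x C => \int[k x]_y l y C.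

Definition kae_eq (p : probability X R) (k l : X -> set X -> \bar R) :=
  forall B, measurable B -> {ae p, forall x, k x B = l x B}.

Definition kernel_measure_preserving (p : probability X R) (e : R.-pker X ~> X) :=
  forall A, measurable A -> \int[p]_x e x A = p A.

Definition as_idempotent (p : probability X R) (e : R.-pker X ~> X) :=
  kae_eq p (kcomp_m e e) (fun x => e x).

Definition kle (p : probability X R) (e1 e2 : R.-pker X ~> X) :=
  kae_eq p (kcomp_m e1 e2) (fun x => e1 x) /\
  kae_eq p (kcomp_m e2 e1) (fun x => e1 x).

Definition kernel_invariant_sets (p : probability X R) (e : R.-pker X ~> X) :
    set (set X) :=
  [set B | measurable B /\
     {ae p, forall x, e x B = (\1_B x)%:E}].

Definition is_sub_sigma_algebra (B : set (set X)) :=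
  sigma_algebra [set: X] B /\ (forall G, B G -> measurable G).

Definition measurable_wrt (B : set (set X)) (g : X -> \bar R) :=
  forall V : set (\bar R), measurable V -> B (g @^-1` V).

(** k is a regular conditional probability P[ . | B]; e_B denotes the
    p-a.s. class of such kernels. *)
Definition is_rcp (p : probability X R) (B : set (set X))
    (k : R.-pker X ~> X) :=
  forall A, measurable A ->
    measurable_wrt B (fun x => k x A) /\
    (forall G, B G -> \int[p]_(x in G) k x A = p (A `&` G)).

End defs.

(* Main.v *)
From HB Require Import structures.
Require Import Defs.
From mathcomp Require Import all_boot all_order all_algebra.
From mathcomp Require Import all_classical all_reals all_analysis.
From mathcomp Require Import measurable_realfun.
Set Implicit Arguments. Unset Strict Implicit. Unset Printing Implicit Defensive.
Import Order.TTheory GRing.Theory Num.Theory.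
Local Open Scope classical_set_scope.
Local Open Scope ring_scope.
Local Open Scope ereal_scope.

(** If every set of [B] is [e]-invariant, then every [B]-measurable function is
    [e x]-almost surely constant for almost all [x], which gives
    [e_B \o e = e_B]; invariance also gives
    [e (A `&` G | x) = 1_G(x) e (A | x)], so that [e \o e_B] and [e_B] have the
    same integrals over the sets of [B].  Conversely, [e_B (G | x) = 1_G(x)]
    almost surely for [G] in [B], and evaluating [e_B \o e = e_B] at [G] shows
    that [G] is invariant, because [e] maps [p]-null sets to [p]-null sets.

    The converse needs a regular conditional probability to exist.  The
    Radon-Nikodym theorem provides conditional distribution functions at all
    reals; the quantile function built from their values at the rationals,
    composed with a Borel left inverse of the embedding of [X] into the reals,
    turns a uniform random variable into one with the conditional law.  Taking
    the image of the uniform law makes countable additivity automatic, and no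
    regularization of the conditional distribution functions is needed. *)

(** * Image measures and comparison of integrands *)

Section image_measure.
Context (d d' : measure_display) (X : measurableType d) (T : measurableType d').
Context (R : realType) (m : {measure set X -> \bar R}) (f : X -> T).

(** The measurability proof is an argument so that the measure structure can be inferred from the
    term alone. *)
Definition image_measure (mf : measurable_fun setT f) : set T -> \bar R :=
  pushforward m f.

Variable mf : measurable_fun setT f.

Let image_measure0 : image_measure mf set0 = 0.
Proof. exact: measure0. Qed.

Let image_measure_ge0 A : 0 <= image_measure mf A.
Proof. exact: measure_ge0. Qed.

Let image_measure_sigma_additive : semi_sigma_additive (image_measure mf).
Proof. exact: measure_semi_sigma_additive. Qed.

HB.instance Definition _ := isMeasure.Build _ _ _ (image_measure mf)
  image_measure0 image_measure_ge0 image_measure_sigma_additive.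

End image_measure.

(** On the set where [g < f], the hypothesis and monotonicity give equal integrals over every
    measurable subset; hence [f = g] almost everywhere there, and the set is null. *)
Lemma le_integral_ae_le (d : measure_display) (T : measurableType d)
    (R : realType) (mu : {measure set T -> \bar R}) (f g : T -> \bar R) :
  mu.-integrable setT f -> mu.-integrable setT g ->
  (forall E, measurable E ->
    \int[mu]_(x in E) f x <= \int[mu]_(x in E) g x) ->
  {ae mu, forall x, f x <= g x}.
Proof.
move=> fi gi fg; pose D := [set x | g x < f x].
have mf := measurable_int _ fi; have mg := measurable_int _ gi.
have mD : measurable D by rewrite -[D]setTI; exact: measurable_lte.
have fiD : mu.-integrable D f by apply: integrableS fi.
have : ae_eq mu D f g.
  apply: integral_ae_eq => //; first exact: measurable_funTS.
  move=> E ED mE; apply/eqP; rewrite eq_le fg//=.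
  apply: le_integral => //; [exact: integrableS gi|exact: integrableS fi|].
  by move=> x /set_mem/ED/ltW.
apply: filterS => x fgx; rewrite leNgt; apply/negP => gfx.
by move: (gfx); rewrite fgx// ltxx.
Qed.

(** * Conditional probability of one event along a map *)

Section conditional_probability.
Context (d d' : measure_display) (X : measurableType d) (T : measurableType d').
Context (R : realType) (p : probability X R) (pi : {mfun X >-> T}).

Lemma conditional_probability_exists (A : set X) : measurable A ->
  exists F : T -> R, [/\ measurable_fun setT F,
    (forall t, (0 <= F t <= 1)%R) &
    forall G, measurable G ->
      \int[distribution p pi]_(t in G) (F t)%:E = p (A `&` pi @^-1` G)].
Proof.
move=> mA.
have mpi G : measurable G -> measurable (pi @^-1` G).
  by move=> mG; rewrite -[X in measurable X]setTI; exact: measurable_funP.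
have mpiT : measurable_fun setT pi by exact: measurable_funP.
pose nu0 : {measure set T -> \bar R} := image_measure (mrestr p mA) mpiT.
have nu0fin : fin_num_fun nu0.
  move=> G mG; apply: (fin_num_measure p).
  by apply: measurableI => //; exact: mpi.
pose nu : {finite_measure set T -> \bar R} :=
  HB.pack (Measure.sort nu0) (Measure_isFinite.Build _ _ _ nu0 nu0fin).
have nuE G : nu G = p (A `&` pi @^-1` G) by rewrite setIC.
pose q := distribution p pi.
have nuq : nu `<< q.
  apply/null_content_dominatesP => G mG qG0; rewrite nuE.
  apply/eqP; rewrite eq_le measure_ge0 andbT -qG0.
  apply: le_measure => //; rewrite inE; last exact: mpi.
  by apply: measurableI => //; exact: mpi.
have [h [h0 hfin hi nuh]] := radon_nikodym_sigma_finite nuq.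
have hE G : measurable G -> \int[q]_(t in G) h t = p (A `&` pi @^-1` G).
  by move=> mG; rewrite -nuE nuh.
have h1 : {ae q, forall t, h t <= 1}.
  apply: (@le_integral_ae_le _ _ _ _ _ (cst 1)) => //.
    by apply: finite_measure_integrable_cst.
  move=> G mG; rewrite hE// integral_cst// mul1e.
  apply: le_measure => //; rewrite inE; last exact: mpi.
  by apply: measurableI => //; exact: mpi.
have mh := measurable_int _ hi.
have mfh : measurable_fun setT (fine \o h) by exact: measurableT_comp.
pose F t := Num.max 0%R (Num.min 1%R (fine (h t))).
have mF : measurable_fun setT F.
  by apply: measurable_maxr => //; apply: measurable_minr.
exists F; split => //.
  by move=> t; rewrite /F le_max lexx/= ge_max ler01/= ge_min lexx.
move=> G mG; rewrite -hE//; apply: ae_eq_integral => //.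
- by apply/measurable_EFinP; exact: measurable_funTS.
- exact: measurable_funTS.
- move: h1; apply: filterS => t h1 _.
  rewrite /F -(fineK (hfin t)); congr EFin => /=.
  rewrite -(fineK (hfin t)) lee_fin in h1.
  by rewrite (min_r h1) max_r// fine_ge0.
Qed.

End conditional_probability.

(** * Conditional quantiles driven by a uniform variable *)

Lemma uniform_prob01_ray (R : realType) (c : R) : (0 <= c <= 1)%R ->
  uniform_prob (@ltr01 R) [set u | (u <= c)%R] = c%:E.
Proof.
move=> /andP[c0 c1]; rewrite /uniform_prob integral_uniform_pdf.
have -> : [set u | (u <= c)%R] `&` `[0%R, 1%R] = `[0%R, c]%classic.
  rewrite !set_itvcc; apply/seteqP; split => u /=.
    by move=> [uc /andP[u0 _]]; rewrite u0.
  by move=> /andP[u0 uc]; split => //; rewrite u0 (le_trans uc).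
rewrite (eq_integral (cst 1)); last first.
  move=> u; rewrite inE/= in_itv/= => /andP[u0 uc].
  by rewrite /uniform_pdf u0 (le_trans uc)//= subr0 invr1.
rewrite integral_cst// mul1e/= lebesgue_measure_itv/= lte_fin sube0.
by case: ltgtP c0 => // <-.
Qed.

Lemma ae_forall_rat (d : measure_display) (T : measurableType d) (R : realType)
    (mu : {measure set T -> \bar R}) (P : T -> rat -> Prop) :
  (forall a, {ae mu, forall t, P t a}) -> {ae mu, forall t a, P t a}.
Proof.
move=> aeP.
have : {ae mu, forall t (n : nat), if unpickle n is Some a then P t a else True}.
  by apply/ae_foralln => n; case: (unpickle n) => [a|]; [exact: aeP|exact: aeW].
by apply: filterS => t Pt a; have := Pt (pickle a); rewrite pickleK.
Qed.

Section quantile_coupling.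
Context (d d' : measure_display) (X : measurableType d) (T : measurableType d').
Context (R : realType) (p : probability X R) (pi : {mfun X >-> T}).
Variables (Y : X -> R) (mY : measurable_fun setT Y).

Let U : probability _ R := uniform_prob (@ltr01 R).
Let q : probability T R := distribution p pi.

Let mpi G : measurable G -> measurable (pi @^-1` G).
Proof.
by move=> mG; rewrite -[X in measurable X]setTI; exact: measurable_funP.
Qed.

Let mYlt r : measurable [set x | (Y x < r)%R].
Proof.
have -> : [set x | (Y x < r)%R] = setT `&` Y @^-1` `]-oo, r[%classic.
  by rewrite setTI; apply/seteqP; split => x /=; rewrite in_itv.
exact: mY.
Qed.

Let F_ex r := cid (conditional_probability_exists p pi (mYlt r)).
Let F r := projT1 (F_ex r).

Let mF r : measurable_fun setT (F r).
Proof. by rewrite /F; case: (F_ex r) => ? []. Qed.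

Let F01 r t : (0 <= F r t <= 1)%R.
Proof. by rewrite /F; case: (F_ex r) => ? []. Qed.

Let FE r G : measurable G ->
  \int[q]_(t in G) (F r t)%:E = p ([set x | (Y x < r)%R] `&` pi @^-1` G).
Proof. by rewrite /F; case: (F_ex r) => ? [? ? +]; exact. Qed.

Let iF r : q.-integrable setT (EFin \o F r).
Proof.
apply/integrableP; split; first exact/measurable_EFinP.
apply: (@le_lt_trans _ _ (\int[q]_t cst 1 t)); last first.
  by rewrite integral_cst// mul1e ltey_eq fin_num_measure.
apply: ge0_le_integral => //; first by do 2 apply: measurableT_comp => //.
by move=> t _ /=; have /andP[F0 F1] := F01 r t; rewrite lee_fin ger0_norm.
Qed.

(** A generalized inverse of [r |-> F r t], where [F r] is a version of the conditional probability
    of [Y < r]. Values are extended reals, since the set of rationals may be empty or unbounded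
    below. *)
Definition quantile (tu : T * R) : \bar R :=
  ereal_inf [set (ratr a)%:E | a in [set a : rat | (tu.2 <= F (ratr a) tu.1)%R]].

Let quantile_lt r t u : (quantile (t, u) < r%:E) <->
  exists2 a : rat, (ratr a < r)%R & (u <= F (ratr a) t)%R.
Proof.
split.
  by move=> /ereal_inf_lt [_ [a /= ua <-]]; rewrite lte_fin => ar; exists a.
move=> [a ar ua]; apply: (@le_lt_trans _ _ (ratr a)%:E); last by rewrite lte_fin.
by apply: ereal_inf_lbound; exists a.
Qed.

Lemma measurable_quantile : measurable_fun setT quantile.
Proof.
apply: (measurability _ (ErealGenInftyO.measurableE R)) => _ /= -[_ [r ->] <-].
rewrite setTI preimage_itvNyo.
pose S (a : rat) : set (T * R) :=
  if (ratr a < r)%R then [set tu | (tu.2 <= F (ratr a) tu.1)%R] else set0.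
(* An infimum is below [r] exactly when some member is, so the strict ray pulls back to a countable
   union of regions under graphs of measurable functions. *)
have -> : [set tu | quantile tu < r%:E] = \bigcup_a S a.
  apply/seteqP; split => [[t u] /quantile_lt[a ar ua]|[t u] [a _]].
    by exists a => //; rewrite /S ar.
  by rewrite /S; case: ifPn => // ar ua; apply/quantile_lt; exists a.
apply: bigcupT_measurable_rat => a; rewrite /S; case: ifPn => // _.
rewrite -[X in measurable X]setTI; apply: measurable_fun_le => //.
by apply: measurableT_comp.
Qed.

Let mH V : measurable V ->
  measurable_fun setT (fun t => U [set u | V (quantile (t, u))]).
Proof.
move=> mV.
have mQV : measurable (quantile @^-1` V).
  by rewrite -[X in measurable X]setTI; exact: measurable_quantile.
rewrite (_ : (fun t => _) = U \o xsection (quantile @^-1` V)); last first.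
  by apply/funext => t /=; rewrite xsectionE.
exact: measurable_fun_xsection.
Qed.

Let msection r t : measurable [set u | quantile (t, u) < r%:E].
Proof.
have -> : [set u | quantile (t, u) < r%:E] =
    xsection (quantile @^-1` `]-oo, r%:E[%classic) t.
  by rewrite xsectionE preimage_itvNyo.
apply: measurable_xsection; rewrite -[X in measurable X]setTI.
by apply: measurable_quantile => //; exact: emeasurable_itv.
Qed.

Let mHray r :
  measurable_fun setT (fun t => U [set u | quantile (t, u) < r%:E]).
Proof. by have := mH (emeasurable_itv `]-oo, r%:E[); rewrite set_itvNyo. Qed.

Let mle (c : R) : measurable [set u : R | (u <= c)%R].
Proof. by rewrite -set_itvNyc. Qed.

Let F_le_quantile r (a : rat) t : (ratr a < r)%R ->
  (F (ratr a) t)%:E <= U [set u | quantile (t, u) < r%:E].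
Proof.
move=> ar; rewrite -(uniform_prob01_ray (F01 (ratr a) t)).
apply: le_measure; rewrite ?inE; [exact: mle|exact: msection|].
by move=> u ua; apply/quantile_lt; exists a.
Qed.

Let quantile_le_F r :
  {ae q, forall t, U [set u | quantile (t, u) < r%:E] <= (F r t)%:E}.
Proof.
(* Monotonicity of [F] holds only almost everywhere for each pair of thresholds; with [r] fixed and
   [a] rational, countably many null sets are discarded. *)
have : {ae q, forall t (a : rat), (ratr a < r)%R -> (F (ratr a) t <= F r t)%R}.
  apply/ae_forall_rat => a; have [ar|ar] := ltP (ratr a) r; last exact: aeW.
  have : {ae q, forall t, (F (ratr a) t)%:E <= (F r t)%:E}.
    apply: (le_integral_ae_le (iF _) (iF _)) => G mG; rewrite /= !FE//.
    apply: le_measure; rewrite ?inE; [exact/measurableI/mpi..|].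
    by apply: setSI => x /= Yx; exact: lt_trans ar.
  by apply: filterS => t; rewrite lee_fin.
apply: filterS => t Fr; rewrite -(uniform_prob01_ray (F01 r t)).
apply: le_measure; rewrite ?inE; [exact: msection|exact: mle|].
by move=> u /quantile_lt[a ar ua]; exact: le_trans (Fr _ ar).
Qed.

Let quantile_ray r G : measurable G ->
  \int[q]_(t in G) U [set u | quantile (t, u) < r%:E] =
  p ([set x | (Y x < r)%R] `&` pi @^-1` G).
Proof.
move=> mG; apply/eqP; rewrite eq_le; apply/andP; split.
  rewrite -FE//; apply: ae_ge0_le_integral => //.
  - exact/measurable_funTS/mHray.
  - by move=> t _; rewrite lee_fin; case/andP: (F01 r t).
  - exact/measurable_funTS/measurable_EFinP.
  - by apply: filterS (quantile_le_F r) => t.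
(* For the lower bound the event [Y < r] is exhausted by smaller thresholds. A rational [a] strictly
   between the threshold and [r] then gives a middle term, the integral of [F (ratr a)]. *)
pose E n := [set x | (Y x < r - n.+1%:R^-1)%R] `&` pi @^-1` G.
have mE n : measurable (E n) by apply: measurableI => //; exact: mpi.
have EU : \bigcup_n E n = [set x | (Y x < r)%R] `&` pi @^-1` G.
  apply/seteqP; split => [x [n _ [/= Yx Gx]]|x [/= Yx Gx]].
    by split => //=; rewrite (lt_le_trans Yx)// gerBl.
  have [n rYn] := ltr_add_invr Yx.
  by exists n => //; split => //=; rewrite ltrBrDr.
have ndE : nondecreasing_seq E.
  move=> m n mn; apply/subsetPset; apply: setSI => x /= Yx.
  by rewrite (lt_le_trans Yx)// lerB// lef_pV2 ?posrE// ler_nat.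
have mUE : measurable (\bigcup_n E n) by exact: bigcupT_measurable.
have /cvg_lim := nondecreasing_cvg_mu (mu := p) mE mUE ndE.
rewrite -EU => <- //; apply: lime_le.
  by apply/cvg_ex; eexists; exact: (nondecreasing_cvg_mu (mu := p) mE mUE ndE).
apply: nearW => n /=.
have [a] : exists a : rat, ratr a \in `](r - n.+1%:R^-1)%R, r[.
  by apply: rat_in_itvoo; rewrite gtrBl.
rewrite in_itv/= => /andP[na ar].
apply: (@le_trans _ _ (\int[q]_(t in G) (F (ratr a) t)%:E)).
  rewrite FE//; apply: le_measure; rewrite ?inE//; first exact/measurableI/mpi.
  by apply: setSI => x /= Yx; exact: lt_trans na.
apply: ge0_le_integral => //.
- by move=> t _; rewrite lee_fin; case/andP: (F01 (ratr a) t).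
- exact/measurable_funTS/measurable_EFinP.
- exact/measurable_funTS/mHray.
- by move=> t _; exact: F_le_quantile.
Qed.

Lemma quantile_coupling V G : measurable V -> measurable G ->
  \int[q]_(t in G) U [set u | V (quantile (t, u))] =
  p ((EFin \o Y) @^-1` V `&` pi @^-1` G).
Proof.
move=> mV mG.
have mEY : measurable_fun setT (EFin \o Y) by exact/measurable_EFinP.
have mGT : measurable (G `*` [set: R]) by exact: measurableX.
(* Both sides are finite measures in [V] that agree on the open left rays and on the whole line.
   These rays are stable under intersection and generate the Borel sets, so the measures
   coincide. *)
pose m1 : {measure set \bar R -> \bar R} :=
  image_measure (mrestr (q \x U) mGT) measurable_quantile.
pose m2 : {measure set \bar R -> \bar R} :=
  image_measure (mrestr p (mpi mG)) mEY.
have m1E W : m1 W = \int[q]_(t in G) U [set u | W (quantile (t, u))].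
  rewrite integral_mkcond; apply: eq_integral => t _ /=.
  rewrite patchE xsectionE; case: ifPn => [/set_mem Gt|/negP Gt].
    by congr (U _); apply/seteqP; split => [u []//|u Wu]; split.
  rewrite (_ : _ @^-1` _ = set0) ?measure0//.
  by apply/seteqP; split => // u [_ [/mem_set]].
rewrite -m1E -[RHS]/(m2 V).
apply: (g_sigma_algebra_measure_unique_trace (@ErealGenInftyO.G R) setT) => //.
- by move=> _ [[r ->] _]; exact: emeasurable_itv.
- move=> _ _ [[r ->] _] [[s ->] _]; split => //; exists (Num.min r s).
  by rewrite !set_itvNyo; apply/seteqP; split => y /=;
    rewrite EFin_min lt_min => /andP.
- rewrite m1E (eq_integral (cst 1)); last first.
    by move=> t _ /=; exact: probability_setT.
  by rewrite integral_cst// mul1e /m2/= /image_measure/= /pushforward /mrestr setTI.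
- move=> _ [[r ->] _]; rewrite m1E /m2/= /image_measure/= /pushforward /mrestr.
  rewrite set_itvNyo quantile_ray//.
- rewrite m1E (eq_integral (cst 1)); last first.
    by move=> t _ /=; exact: probability_setT.
  by rewrite integral_cst// mul1e ltey_eq fin_num_measure.
- suff -> : [set W | ErealGenInftyO.G W /\ W `<=` setT] = @ErealGenInftyO.G R.
    by move: mV; rewrite /measurable/= ErealGenInftyO.measurableE.
  by apply/seteqP; split => [W []|W].
Qed.

End quantile_coupling.

(** * Disintegration on standard Borel spaces *)

Section random_map_kernel.
Context (d d1 d2 : measure_display) (S : measurableType d).
Context (W : measurableType d1) (Y : measurableType d2) (R : realType).
Variables (P : probability W R) (h : S * W -> Y).
Hypothesis mh : measurable_fun setT h.

Let mhs s : measurable_fun setT (fun w => h (s, w)).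
Proof. exact: measurableT_comp. Qed.

Definition random_map_kernel (s : S) : {measure set Y -> \bar R} :=
  image_measure P (mhs s).

Lemma measurable_random_map_kernel A : measurable A ->
  measurable_fun setT (random_map_kernel ^~ A).
Proof.
move=> mA.
have mhA : measurable (h @^-1` A).
  by rewrite -[X in measurable X]setTI; exact: mh.
have -> : random_map_kernel ^~ A = P \o xsection (h @^-1` A).
  by apply/funext => s /=; rewrite xsectionE.
exact: measurable_fun_xsection.
Qed.

HB.instance Definition _ := isKernel.Build _ _ _ _ _
  random_map_kernel measurable_random_map_kernel.

Let random_map_kernel_setT s : random_map_kernel s setT = 1.
Proof. exact: probability_setT. Qed.

HB.instance Definition _ := Kernel_isProbability.Build _ _ _ _ _
  random_map_kernel random_map_kernel_setT.

End random_map_kernel.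

Section comap_kernel.
Context (d d1 d2 : measure_display) (S : measurableType d).
Context (T : measurableType d1) (Y : measurableType d2) (R : realType).
Variables (k : R.-pker T ~> Y) (pi : {mfun S >-> T}).

Definition comap_kernel (s : S) : {measure set Y -> \bar R} := k (pi s).

Let measurable_comap_kernel A : measurable A ->
  measurable_fun setT (comap_kernel ^~ A).
Proof.
by move=> mA; apply: measurableT_comp (measurable_kernel k A mA) _.
Qed.

HB.instance Definition _ := isKernel.Build _ _ _ _ _
  comap_kernel measurable_comap_kernel.

Let comap_kernel_setT s : comap_kernel s setT = 1.
Proof. exact: prob_kernel. Qed.

HB.instance Definition _ := Kernel_isProbability.Build _ _ _ _ _
  comap_kernel comap_kernel_setT.

End comap_kernel.

(** The left inverse is defined on the extended reals, where the quantile takes its values; it sends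
    everything outside the image of [X] to [point]. *)
Lemma standard_Borel_left_inverse (d : measure_display) (X : measurableType d)
    (R : realType) : @standard_Borel d X R ->
  exists (f : X -> R) (g : \bar R -> X), [/\ measurable_fun setT f,
    measurable_fun setT g & forall x, g (f x)%:E = x].
Proof.
move=> [f [finj mf mrf mfA]].
pose g (y : \bar R) : X := xget point [set x | (f x)%:E = y].
have gf x : g (f x)%:E = x.
  by rewrite /g; case: xgetP => [z _ /= [/finj]//|/(_ x)[]].
exists f, g; split => // _ A mA; rewrite setTI.
have mEf C : measurable C -> measurable ((EFin \o f) @` C).
  by move=> mC; rewrite -image_comp; apply: measurable_image_EFin; exact: mfA.
(* The preimage of [A] is its image in the extended reals, enlarged by the complement of the whole
   image exactly when [A] contains the default value. *)
have [Ap|Ap] := pselect (A point).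
  have -> : g @^-1` A = (EFin \o f) @` A `|` ~` ((EFin \o f) @` setT).
    apply/seteqP; split => [y Agy|y [[x Ax <-]|ny]]; last 2 first.
    - by rewrite /= gf.
    - rewrite /= /g; case: xgetP => // z _ zy.
      by exfalso; apply: ny; exists z.
    have [[x _ xy]|ny] := pselect (((EFin \o f) @` setT) y); last by right.
    by left; exists x => //; rewrite -[x]gf; move: Agy; rewrite -xy.
  by apply: measurableU; [exact: mEf|apply: measurableC; exact: mEf].
have -> : g @^-1` A = (EFin \o f) @` A; last exact: mEf.
apply/seteqP; split => [y|y [x Ax <-]]; last by rewrite /= gf.
rewrite /= {1}/g; case: xgetP => [z _ zy Az|//].
by exists z.
Qed.

Lemma standard_Borel_disintegration (d d' : measure_display)
    (X : measurableType d) (T : measurableType d') (R : realType)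
    (p : probability X R) (pi : {mfun X >-> T}) :
  @standard_Borel d X R ->
  exists k : R.-pker T ~> X, forall A G, measurable A -> measurable G ->
    \int[p]_(x in pi @^-1` G) k (pi x) A = p (A `&` pi @^-1` G).
Proof.
move=> /standard_Borel_left_inverse[f [g [mf mg gf]]].
have mh : measurable_fun setT (g \o quantile p pi mf).
  by apply: measurableT_comp => //; exact: measurable_quantile.
exists (random_map_kernel (uniform_prob (@ltr01 R)) mh) => A G mA mG.
have mgA : measurable (g @^-1` A) by rewrite -[X in measurable X]setTI; exact: mg.
have := quantile_coupling p pi mf mgA mG.
rewrite (_ : (EFin \o f) @^-1` (g @^-1` A) = A); last first.
  by apply/seteqP; split => x /=; rewrite gf.
move=> <-; rewrite ge0_integral_pushforward//.
exact: measurable_funTS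
  (measurable_random_map_kernel (uniform_prob (@ltr01 R)) mh mA).
Qed.

(** Disintegration along the identity from [X] to the same set equipped with [B]: a kernel out of
    the latter space is [B]-measurable by construction. *)
Lemma rcp_exists (d : measure_display) (X : measurableType d) (R : realType)
    (p : probability X R) (B : set (set X)) :
  @standard_Borel d X R -> is_sub_sigma_algebra B ->
  exists k : R.-pker X ~> X, is_rcp p B k.
Proof.
move=> sX [sB Bm].
have mB : @measurable _ (g_sigma_algebraType B) = B by exact: sigma_algebra_id.
have mid : measurable_fun setT (id : X -> g_sigma_algebraType B).
  by move=> _ A; rewrite mB setTI; exact: Bm.
pose pi : {mfun X >-> g_sigma_algebraType B} :=
  HB.pack (id : X -> g_sigma_algebraType B) (isMeasurableFun.Build _ _ _ _ _ mid).
have [k kE] := standard_Borel_disintegration p pi sX.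
exists (comap_kernel k pi) => A mA; split => [V mV|G BG].
  have mkA := measurable_kernel k A mA measurableT V mV.
  by move: mkA; rewrite setTI mB.
by apply: kE => //; rewrite mB.
Qed.

(** * Measure-preserving kernels *)

Lemma prob_kernel_setC (d d' : measure_display) (X : measurableType d)
    (Y : measurableType d') (R : realType) (k : R.-pker X ~> Y) x G :
  measurable G -> k x (~` G) = 1 - k x G.
Proof.
move=> mG; have kT : k x setT = 1 by exact: prob_kernel.
rewrite -setTD measureD//; first by rewrite setTI; congr (_ - _).
by rewrite [X in X < _]kT ltry.
Qed.

Section measure_preserving_kernel.
Context (d : measure_display) (X : measurableType d) (R : realType).
Variables (p : probability X R) (e : R.-pker X ~> X).
Hypothesis pe : kernel_measure_preserving p e.

Lemma measure_preserving_null N : measurable N -> p N = 0 ->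
  {ae p, forall x, e x N = 0}.
Proof.
move=> mN pN0.
have : ae_eq p setT (e ^~ N) (cst 0).
  apply/ae_eq_integral_abs => //; first exact: measurable_kernel.
  by under eq_integral do rewrite gee0_abs//; rewrite pe.
by apply: filterS => x; exact.
Qed.

Lemma measure_preserving_ae (P : set X) : {ae p, forall x, P x} ->
  {ae p, forall x, {ae e x, forall y, P y}}.
Proof.
move=> [N [mN pN0 PN]]; apply: filterS (measure_preserving_null mN pN0) => x eN.
by exists N.
Qed.

Lemma integral_measure_preserving (g : X -> \bar R) :
  (forall y, 0 <= g y) -> measurable_fun setT g ->
  \int[p]_x (\int[e x]_y g y) = \int[p]_x g x.
Proof.
move=> g0 mg.
(* To use the integral formula for composed kernels, [p] is viewed as a kernel out of the one-point
   space and [e] as a kernel with a dummy parameter. *)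
have msnd : measurable_fun setT (snd : unit * X -> X) by exact: measurable_snd.
pose sndm : {mfun (unit * X)%type >-> X} :=
  HB.pack (snd : unit * X -> X) (isMeasurableFun.Build _ _ _ _ _ msnd).
have := integral_kcomp (random_map_kernel p msnd) (comap_kernel e sndm) tt g0 mg.
rewrite [RHS](eq_measure_integral p) => [<-|A mA _ //].
by apply: eq_measure_integral => A mA _; exact: (pe mA).
Qed.

End measure_preserving_kernel.

(** * Sub-sigma-algebras and regular conditional probabilities *)

Section sub_sigma_algebra.
Context (d : measure_display) (X : measurableType d) (R : realType).
Variables (p : probability X R) (B : set (set X)).
Hypothesis sB : is_sub_sigma_algebra B.

Let BE (A : set X) : @measurable _ (g_sigma_algebraType B) A = B A.
Proof.
by have [sB' _] := sB; exact: (congr1 (@^~ A) (sigma_algebra_id sB')).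
Qed.

Lemma measurable_wrtP (g : X -> \bar R) :
  measurable_wrt B g <-> measurable_fun [set: g_sigma_algebraType B] g.
Proof.
split=> [mg _ V mV|mg V mV]; first by rewrite setTI BE; exact: mg.
by rewrite -BE -[X in measurable X]setTI; exact: mg.
Qed.

Lemma measurable_wrt_measurable (g : X -> \bar R) :
  measurable_wrt B g -> measurable_fun setT g.
Proof. by move=> mg _ V mV; rewrite setTI; exact/(proj2 sB)/mg. Qed.

(** Uniqueness of conditional expectations: [p] is transported to the space whose measurable sets
    are those of [B], so that sets of [B] are enough as tests; a null set found there is also null
    for [p]. *)
Lemma measurable_wrt_ae_eq (f g : X -> \bar R) :
  measurable_wrt B f -> measurable_wrt B g ->
  (forall x, 0 <= f x <= 1) -> (forall x, 0 <= g x) ->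
  (forall G, B G -> \int[p]_(x in G) f x = \int[p]_(x in G) g x) ->
  {ae p, forall x, f x = g x}.
Proof.
move=> mf mg f01 g0 fg.
have mid : measurable_fun setT (id : X -> g_sigma_algebraType B).
  by move=> _ A; rewrite BE setTI; exact: (proj2 sB).
pose q := image_measure p mid.
have qE h G : measurable_wrt B h -> (forall x, 0 <= h x) -> B G ->
    \int[q]_(x in G) h x = \int[p]_(x in G) h x.
  move=> /measurable_wrtP mh h0 BG; rewrite ge0_integral_pushforward ?BE//.
  exact: measurable_funTS.
have f0 x : 0 <= f x by case/andP: (f01 x).
have BT : B setT by rewrite -BE.
have fi : q.-integrable setT f.
  apply/integrableP; split; first exact/measurable_wrtP.
  under eq_integral do rewrite gee0_abs//.
  rewrite qE//; apply: (@le_lt_trans _ _ (\int[p]_x cst 1 x)).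
    apply: ge0_le_integral => //; first exact: measurable_wrt_measurable.
    by move=> x _; case/andP: (f01 x).
  by rewrite integral_cst// mul1e ltey_eq fin_num_measure.
have [N [mN qN fgN]] : ae_eq q setT f g.
  apply: integral_ae_eq => //; first exact/measurable_wrtP.
  by move=> E _; rewrite BE => BE'; rewrite !qE//; exact: fg.
exists N; split => //; first by apply: (proj2 sB); rewrite -BE.
by move=> x /= nfg; apply: fgN => /= fgx; apply: nfg; exact: fgx.
Qed.

Lemma rcp_indicator (k : R.-pker X ~> X) G : is_rcp p B k -> B G ->
  {ae p, forall x, k x G = (\1_G x)%:E}.
Proof.
move=> rk BG; have mG := proj2 sB _ BG.
have BC : B (~` G) by rewrite -BE; apply: measurableC; rewrite BE.
have aux H A : B H -> measurable A -> A `&` H = set0 -> ae_eq p H (k ^~ A) (cst 0).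
  move=> BH mA AH; have mH := proj2 sB _ BH.
  apply/ae_eq_integral_abs => //; first exact/measurable_funTS/measurable_kernel.
  by under eq_integral do rewrite gee0_abs//; rewrite (proj2 (rk A mA))// AH measure0.
have := aux _ _ BC mG (setICr _); have := aux _ _ BG (measurableC mG) (setICl _).
apply: filterS2 => x kC kG; rewrite indicE.
have [/set_mem Gx|/negP nGx] := boolP (x \in G).
  by rewrite -[G]setCK prob_kernel_setC ?kC// ?sube0//; exact: measurableC.
by apply: kG => /mem_set.
Qed.

End sub_sigma_algebra.

(** * Invariant sub-sigma-algebras *)

Lemma prob_kernel_le1 (d d' : measure_display) (X : measurableType d)
    (Y : measurableType d') (R : realType) (k : R.-pker X ~> Y) x A :
  measurable A -> k x A <= 1.
Proof.
move=> mA; rewrite -(prob_kernel (s := k) x).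
by apply: le_measure; rewrite ?inE.
Qed.

Lemma ae_eq_measure (d : measure_display) (X : measurableType d)
    (R : realType) (mu : {measure set X -> \bar R}) (A C : set X) :
  measurable A -> measurable C -> {ae mu, forall x, A x <-> C x} ->
  mu A = mu C.
Proof.
move=> mA mC AC.
rewrite -[A]setIT -[C]setIT -!integral_indic//; apply: ae_eq_integral => //;
  [exact/measurable_EFinP/measurable_indic..|].
apply: filterS AC => x AC _ /=; congr EFin.
by rewrite !indicE; congr ((_ : bool)%:R); apply/idP/idP; rewrite !inE => /AC.
Qed.

(** The value is 0 or 1, so [e x] ignores either [G] or its complement. *)
Lemma prob_kernel_indicator_ae (d : measure_display) (X : measurableType d)
    (R : realType) (e : R.-pker X ~> X) x G :
  measurable G -> e x G = (\1_G x)%:E -> {ae e x, forall y, G y <-> G x}.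
Proof.
move=> mG; rewrite indicE; have [/set_mem Gx|/negP nGx] := boolP (x \in G) => eG.
  exists (~` G); split; [exact: measurableC| |by move=> y /= + Gy; apply].
  by rewrite prob_kernel_setC// eG subee.
exists G; split => //= y /= nGy; apply: contrapT => Gy; apply: nGy.
by split => // /mem_set.
Qed.

Section invariant_sub_sigma_algebra.
Context (d : measure_display) (X : measurableType d) (R : realType).
Variables (p : probability X R) (e : R.-pker X ~> X) (B : set (set X)).
Hypothesis sB : is_sub_sigma_algebra B.
Hypothesis BI : B `<=` kernel_invariant_sets p e.

(* The level sets [h < a] with [a] rational are invariant and separate the
   values of [h]. *)
Lemma measurable_wrt_ae_cst (h : X -> R) : measurable_wrt B (EFin \o h) ->
  {ae p, forall x, {ae e x, forall y, h y = h x}}.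
Proof.
move=> mh.
have Bh (a : rat) : B [set y | (h y < ratr a)%R].
  have := mh _ (emeasurable_itv `]-oo, (ratr a)%:E[).
  by rewrite set_itvNyo.
have : {ae p, forall x (a : rat), e x [set y | (h y < ratr a)%R] =
    (\1_[set y | (h y < ratr a)%R] x)%:E}.
  by apply: ae_forall_rat => a; have [] := BI (Bh a).
apply: filterS => x ex.
have : {ae e x, forall y (a : rat), (h y < ratr a)%R <-> (h x < ratr a)%R}.
  apply: ae_forall_rat => a.
  exact: (prob_kernel_indicator_ae (proj2 sB _ (Bh a)) (ex a)).
apply: filterS => y hyx; apply/eqP; rewrite eq_le !leNgt.
apply/andP; split; apply/negP => /rat_in_itvoo[a]; rewrite in_itv/= => /andP[].
  by move=> /(hyx a).2 ya /ltW; rewrite leNgt ya.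
by move=> /(hyx a).1 xa /ltW; rewrite leNgt xa.
Qed.

Variable k : R.-pker X ~> X.
Hypothesis rk : is_rcp p B k.

Lemma rcp_comp_invariant : kae_eq p (kcomp_m k e) (fun x => k x).
Proof.
move=> A mA.
have kfin x : k x A \is a fin_num.
  by rewrite ge0_fin_numE// (le_lt_trans (prob_kernel_le1 _ _ mA))// ltry.
have kE : EFin \o (fun x => fine (k x A)) = k ^~ A.
  by apply/funext => x /=; rewrite fineK.
have : measurable_wrt B (EFin \o (fun x => fine (k x A))).
  by rewrite kE; exact: (proj1 (rk mA)).
move=> /measurable_wrt_ae_cst; apply: filterS => x kx.
rewrite /kcomp_m (ae_eq_integral (cst (k x A)))//.
- by rewrite integral_cst// [X in _ * X]prob_kernel mule1.
- exact: measurable_kernel.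
- by apply: filterS kx => y kyx _ /=; rewrite -(fineK (kfin y)) kyx fineK.
Qed.

Lemma invariant_kernel_setI G A : B G -> measurable A ->
  {ae p, forall x, e x (A `&` G) = ((e ^~ A) \_ G) x}.
Proof.
move=> BG mA; have mG := proj2 sB _ BG.
have [_] := BI BG; apply: filterS => x eG.
have {}eG := prob_kernel_indicator_ae mG eG.
rewrite patchE; case: ifPn => [/set_mem Gx|/negP nGx].
  apply: ae_eq_measure; [exact: measurableI|by []|].
  by apply: filterS eG => y [_ /(_ Gx) Gy]; split => [[]|].
rewrite -[RHS](measure0 (e x)); apply: ae_eq_measure; [exact: measurableI|by []|].
by apply: filterS eG => y [Gyx _]; split => // -[_ /Gyx/mem_set].
Qed.

Lemma invariant_comp_rcp : kernel_measure_preserving p e ->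
  kae_eq p (kcomp_m e k) (fun x => k x).
Proof.
move=> pe A mA.
have mT : B setT.
  by case: sB => -[B0 BC _] _; rewrite -(setD0 setT); exact: BC.
have pk : kernel_measure_preserving p k.
  by move=> C mC; rewrite (proj2 (rk mC))// setIT.
have meA : measurable_fun setT (e ^~ A) by exact: measurable_kernel.
have H0 x : 0 <= kcomp_m e k x A by exact: integral_ge0.
have mH : measurable_wrt B (kcomp_m e k ^~ A).
  (* [k] is also a kernel out of the space equipped with [B], so integrating against it gives a
     [B]-measurable function. *)
  apply/(measurable_wrtP sB).
  apply: (@measurable_fun_integral_kernel _ _ (g_sigma_algebraType B)) => //.
  by move=> C mC; apply/(measurable_wrtP sB); exact: (proj1 (rk mC)).
suff : {ae p, forall x, k x A = kcomp_m e k x A} by apply: filterS => x ->.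
apply: (measurable_wrt_ae_eq sB) => //; first exact: (proj1 (rk mA)).
  by move=> x; rewrite measure_ge0 prob_kernel_le1.
move=> G BG; have mG := proj2 sB _ BG.
have meAG : measurable_fun setT ((e ^~ A) \_ G).
  exact/(measurable_restrictT _ mG)/measurable_funTS.
have eAG0 y : 0 <= ((e ^~ A) \_ G) y by rewrite patchE; case: ifP.
(* The integral of [k x A] over [G] is [p (A]&[G)], hence the integral of [e x (A]&[G)], hence that
   of [e x A] cut off outside [G]; since [k] preserves [p], that function may first be averaged by
   [k]. *)
rewrite (proj2 (rk mA))// -pe; last exact: measurableI.
rewrite (ae_eq_integral ((e ^~ A) \_ G))//; last 2 first.
- exact/measurable_kernel/measurableI.
- by apply: filterS (invariant_kernel_setI BG mA).
rewrite -(integral_measure_preserving pk)// [RHS]integral_mkcond.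
apply: ae_eq_integral => //.
- exact: measurable_fun_integral_kernel (fun C => measurable_kernel k C) _ _ _.
- apply/(measurable_restrictT _ mG)/measurable_funTS.
  exact: (measurable_wrt_measurable sB).
(* Almost surely [k x] is carried by [G] or by its complement, according to [x], so the cut-off
   leaves the inner integral. *)
apply: filterS (rcp_indicator sB rk BG) => x kG _.
have {}kG := prob_kernel_indicator_ae mG kG.
rewrite [RHS]patchE; case: ifPn => [/set_mem Gx|/negP nGx].
  apply: ae_eq_integral => //; apply: filterS kG => y [_ /(_ Gx) Gy] _.
  by rewrite patchE mem_set.
rewrite -[RHS](integral0 (k x) setT); apply: ae_eq_integral => //.
apply: filterS kG => y [Gyx _] _; rewrite patchE; case: ifPn => // /set_mem.
by move=> /Gyx/mem_set.
Qed.

End invariant_sub_sigma_algebra.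

(** * Invariance of the sigma-algebra against the order on idempotents *)

Theorem theorem4p13 (d : measure_display) (X : measurableType d)
  (R : realType) (p : probability X R) (e : R.-pker X ~> X)
  (B : set (set X)) :
  @standard_Borel d X R ->
  kernel_measure_preserving p e ->
  as_idempotent p e ->
  is_sub_sigma_algebra B ->
  (B `<=` kernel_invariant_sets p e <->
   (forall eB : R.-pker X ~> X, is_rcp p B eB -> kle p eB e)).
Proof.
move=> sX pe _ sB; split=> [BI eB reB|].
  by split; [exact: rcp_comp_invariant reB|exact: invariant_comp_rcp reB pe].
have [eB reB] := rcp_exists p sX sB.
move=> /(_ eB reB)[eBe _] G BG; have mG := proj2 sB _ BG; split => //.
have eBG := rcp_indicator sB reB BG.
(* For almost all [x], [e x G] is the integral of [eB y G] against [e x], which equals [eB x G] by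
   the order relation and so the indicator of [G] at [x]. *)
move: (measure_preserving_ae pe eBG) (eBe G mG) (eBG).
apply: filterS3 => x eBy eBx <-; rewrite -eBx /kcomp_m.
rewrite (ae_eq_integral (fun y => (\1_G y)%:E))//.
- by rewrite integral_indic// setIT.
- exact: measurable_kernel.
- exact/measurable_EFinP/measurable_indic.
- by apply: filterS eBy.
Qed.
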